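(* Let $G$ be a finite solvable group. Then $\Gamma^*(G)$ is connected and $\mathrm{diam}(\Gamma^*(G))\leq 4$. If $G$ is moreover nilpotent, then $\mathrm{diam}(\Gamma^*(G))\leq 3$, and $\Gamma^*(G)=\Gamma(G)$ if and only if $\Phi(G)$ is trivial.
   Context: For a group $G$, the co-maximal subgroup graph $\Gamma(G)$ is the simple undirected graph whose vertices are the non-trivial proper subgroups of $G$, two distinct vertices $H,K$ being adjacent if and only if $HK=G$, where $HK=\{hk : h\in H, k\in K\}$. The deleted co-maximal subgroup graph $\Gamma^*(G)$ is the graph obtained by removing all isolated vertices from $\Gamma(G)$. $\Phi(G)$ denotes the Frattini subgroup, i.e. the intersection of all maximal subgroups of $G$ (for the trivial group, $\Phi(G)$ is trivial). The diameter is the maximum distance between two vertices. The graph with no vertices is regarded as trivially connected and as trivially satisfying the diameter bounds. *)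

(* Defs.v *)
From mathcomp Require Import all_boot all_fingroup all_solvable.

Set Implicit Arguments.
Unset Strict Implicit.
Unset Printing Implicit Defensive.

Import GroupScope.

(* A finite simple undirected graph with vertices in T; an edge is an unordered
   pair of distinct vertices. Equality of graphs is Leibniz equality of these
   records, i.e. same vertex set and same edge set. *)
Record sgraph (T : finType) := SGraph {
  vertices : {set T};
  edges : {set {set T}};
  edges_wf : [forall e in edges, (e \subset vertices) && (#|e| == 2)]
}.

Definition adj (T : finType) (X : sgraph T) : rel T :=
  fun x y => [set x; y] \in edges X.

Definition isolated (T : finType) (X : sgraph T) : pred T :=
  fun x => ~~ [exists y, adj X x y].

Lemma delete_isolated_wf (T : finType) (X : sgraph T) :
  [forall e in edges X,
    (e \subset [set x in vertices X | ~~ isolated X x]) && (#|e| == 2)].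
Proof.
apply/forall_inP => e eX.
have /andP[eV e2] := forall_inP (edges_wf X) e eX.
rewrite e2 andbT; apply/subsetP => x xe.
rewrite inE (subsetP eV x xe) negbK.
have /cards2P[a [b [_ def_e]]] := e2.
move: xe; rewrite def_e !inE => /orP[] /eqP->; apply/existsP.
  by exists b; rewrite /adj -def_e.
by exists a; rewrite /adj setUC -def_e.
Qed.

Definition delete_isolated (T : finType) (X : sgraph T) : sgraph T :=
  @SGraph T [set x in vertices X | ~~ isolated X x] (edges X)
    (delete_isolated_wf X).

Definition connected (T : finType) (X : sgraph T) : Prop :=
  {in vertices X &, forall x y, connect (adj X) x y}.

Definition has_walk (T : finType) (X : sgraph T) (x y : T) (n : nat) : bool :=
  [exists p : n.-tuple T, path (adj X) x p && (last x p == y)].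

(* Length of a shortest walk from x to y. Distances are less than #|T|, and the
   value is #|T| when there is no walk. *)
Definition dist (T : finType) (X : sgraph T) (x y : T) : nat :=
  find (has_walk X x y) (iota 0 #|T|).

(* This is 0 for the graph without vertices; it is the usual diameter only when
   X is connected. *)
Definition diam (T : finType) (X : sgraph T) : nat :=
  \max_(x in vertices X) \max_(y in vertices X) dist X x y.

Section Comaximal.

Variables (gT : finGroupType) (G : {group gT}).

Definition comax_vertices : {set {group gT}} :=
  [set H : {group gT} | (H :!=: 1) && (H \proper G)].

(* H * K is the set product; H * K = G is symmetric in H and K for subgroups. *)
Definition comax_edges : {set {set {group gT}}} :=
  [set [set H; K] | H in comax_vertices, K in comax_vertices
                  & (H != K) && (H * K == G :> {set gT})].

Lemma comax_wf :
  [forall e in comax_edges, (e \subset comax_vertices) && (#|e| == 2)].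
Proof.
apply/forall_inP => e /imset2P[H K HV]; rewrite inE => /and3P[KV neqHK _] ->.
by rewrite subUset !sub1set HV KV cards2 neqHK.
Qed.

Definition comax_graph : sgraph {group gT} :=
  @SGraph {group gT} comax_vertices comax_edges comax_wf.

Definition deleted_comax_graph : sgraph {group gT} :=
  delete_isolated comax_graph.

End Comaximal.

(* Main.v *)
Require Import Defs.
From mathcomp Require Import all_boot all_fingroup all_solvable.

(** Two proper subgroups H and K are adjacent exactly when [H * K = G], and
    enlarging K inside G keeps this equation. Hence every non-isolated H is
    adjacent to a maximal subgroup M ([deleted_comax_maximal_neighbour]), and
    it suffices to join two maximal subgroups M and N by a walk of length at
    most 2, or at most 1 when G is nilpotent; a walk between arbitrary vertices
    is at most 2 steps longer.

    A normal subgroup not contained in a maximal subgroup M has product G with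
    M ([normal_maximal_mulg]). So if M or N is normal and M, N are distinct,
    then [M * N = G]. If neither is normal, neither contains the derived
    subgroup of G, because every subgroup above the derived subgroup is normal;
    the derived subgroup is then a common neighbour of M and N, and it is a
    proper subgroup because G is solvable. In a nilpotent group every maximal
    subgroup is normal and only the first case occurs.

    The isolated vertices of a nilpotent group are therefore the proper
    nontrivial subgroups that lie in every maximal subgroup, that is, in the
    Frattini subgroup. When the latter is nontrivial it is itself one of them,
    since its elements are nongenerators. *)

Set Implicit Arguments.
Unset Strict Implicit.
Unset Printing Implicit Defensive.

Import GroupScope.

Section Graphs.

Variables (T : finType) (X : sgraph T).

Lemma sgraph_inj (Y : sgraph T) :
  vertices X = vertices Y -> edges X = edges Y -> X = Y.
Proof.
case: X Y => [V E wfE] [V' E' wfE'] /= eqV eqE; rewrite -{}eqV -{}eqE in wfE' *.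
by congr SGraph; apply: bool_irrelevance.
Qed.

Lemma has_walkP x y n :
  reflect (exists p, [/\ size p = n, path (adj X) x p & last x p = y])
          (has_walk X x y n).
Proof.
apply: (iffP existsP) => [[p /andP[Xp /eqP px]]|[p [pn Xp px]]].
  by exists p; rewrite size_tuple.
by move/eqP: pn => pn; exists (Tuple pn); rewrite Xp px eqxx.
Qed.

(** When n is at least [#|T|], the bound holds because [dist] never exceeds
    [#|T|]. *)
Lemma dist_le_walk x y n : has_walk X x y n -> dist X x y <= n.
Proof.
move=> walk_n; have [lt_n | ge_n] := ltnP n #|T|; last first.
  by rewrite (leq_trans (find_size _ _)) ?size_iota.
rewrite leqNgt; apply/negP => /(before_find 0).
by rewrite nth_iota // add0n walk_n.
Qed.

Definition short_walks d :=
  {in vertices X &, forall x y, exists2 n, n <= d & has_walk X x y n}.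

Lemma short_walks_connected d : short_walks d -> connected X.
Proof.
move=> walkX x y Vx Vy; have [n _ /has_walkP[p [_ Xp px]]] := walkX x y Vx Vy.
by apply/connectP; exists p.
Qed.

Lemma short_walks_diam d : short_walks d -> diam X <= d.
Proof.
move=> walkX; apply/bigmax_leqP => x Vx; apply/bigmax_leqP => y Vy.
by have [n le_nd /dist_le_walk/leq_trans->] := walkX x y Vx Vy.
Qed.

End Graphs.

Section Comaximal.

Variables (gT : finGroupType) (G : {group gT}).
Implicit Types H K M N : {group gT}.

Lemma mulG_eq_groupC H K : H * K = G -> K * H = G.
Proof. by move=> HK; rewrite -(invGid G) -HK invMg !invGid. Qed.

(** The nontriviality and distinctness conditions on an edge disappear: if H is
    trivial then [H * K] is K, and if [H = K] then [H * K] is H, neither of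
    which is G. *)
Lemma comax_adjE H K :
  adj (comax_graph G) H K = [&& H \proper G, K \proper G & H * K == G].
Proof.
apply/imset2P/and3P => [[A B] | [prH prK /eqP HK]].
  rewrite !inE => /andP[_ prA] /and3P[/andP[_ prB] neqAB /eqP AB] eqHK.
  have neqHK : H != K.
    by have := cards2 A B; rewrite -eqHK cards2 neqAB; case: (H != K).
  have : H \in [set A; B] by rewrite -eqHK set21.
  have : K \in [set A; B] by rewrite -eqHK set22.
  rewrite !inE => /orP[] /eqP eK /orP[] /eqP eH; move: neqHK.
  - by rewrite eH eK eqxx.
  - by rewrite eH eK prA prB (mulG_eq_groupC AB).
  - by rewrite eH eK prA prB AB.
  - by rewrite eH eK eqxx.
exists H K => //; rewrite !inE ?prH ?prK ?HK ?eqxx ?andbT.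
  by apply: contraTneq prK => H1; rewrite -HK H1 mul1g properxx.
apply/andP; split.
  by apply: contraTneq prH => K1; rewrite -HK K1 mulg1 properxx.
by apply: contraTneq prH => eqHK; rewrite -HK -eqHK mulGid properxx.
Qed.

Lemma comax_adjP H K :
  reflect [/\ H \proper G, K \proper G & H * K = G]
          (adj (deleted_comax_graph G) H K).
Proof.
rewrite [adj _ _ _]comax_adjE.
by apply: (iffP and3P) => -[prH prK] => [/eqP | ->].
Qed.

Lemma comax_adj_sym H K :
  adj (deleted_comax_graph G) H K -> adj (deleted_comax_graph G) K H.
Proof.
case/comax_adjP=> prH prK HK; apply/comax_adjP.
by split=> //; apply: mulG_eq_groupC.
Qed.

Lemma maximal_overgroup M K :
  maximal M G -> M \subset K -> K \subset G -> K :=: M \/ K :=: G.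
Proof.
move=> maxM; have /maximal_eqP[_] : maximal_eq M G by apply/predU1r.
exact.
Qed.

Lemma deleted_comax_maximal_neighbour H :
  H \in vertices (deleted_comax_graph G) ->
  exists2 M : {group gT}, maximal M G & adj (deleted_comax_graph G) H M.
Proof.
rewrite inE negbK => /andP[_ /existsP[K /comax_adjP[prH prK HK]]].
have [eqKG | [M maxM sKM]] := maximal_exists (proper_sub prK).
  by rewrite eqKG properxx in prK.
exists M => //; apply/comax_adjP; split=> //; first exact: maxgroupp maxM.
have sMG := proper_sub (maxgroupp maxM).
by apply/eqP; rewrite eqEsubset mul_subG ?(proper_sub prH) //= -{1}HK mulgS.
Qed.

(** The product with a normal subgroup is a subgroup, and it lies strictly above
    the maximal subgroup M. *)
Lemma normal_maximal_mulg M K :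
  maximal M G -> K <| G -> ~~ (K \subset M) -> M * K = G.
Proof.
move=> maxM /andP[sKG nKG] not_sKM.
have sMG := proper_sub (maxgroupp maxM).
rewrite -norm_joinEl ?(subset_trans sMG) //.
have sMK_G : M <*> K \subset G by rewrite join_subG sMG.
case: (maximal_overgroup maxM (joing_subl M K) sMK_G) => //= eqM.
by rewrite -eqM joing_subr in not_sKM.
Qed.

(** A maximal subgroup contained in a proper subgroup is equal to it, so
    neither of two distinct maximal subgroups contains the other. *)
Lemma normal_maximal_adj M N :
  maximal M G -> maximal N G -> M != N -> N <| G ->
  adj (deleted_comax_graph G) M N.
Proof.
move=> maxM maxN neqMN nNG; apply/comax_adjP.
split; [exact: maxgroupp maxM | exact: maxgroupp maxN |].
apply: normal_maximal_mulg => //.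
apply: contra neqMN => sNM.
have sMG := proper_sub (maxgroupp maxM).
have [eqMN | eqMG] := maximal_overgroup maxN sNM sMG.
  exact/eqP/val_inj.
by have := maxgroupp maxM; rewrite eqMG properxx.
Qed.

(** The neighbour obtained does not depend on M, which makes the derived subgroup a common
    neighbour of all non-normal maximal subgroups. *)
Lemma der1_nonnormal_maximal_adj M :
  solvable G -> maximal M G -> ~~ (M <| G) ->
  adj (deleted_comax_graph G) M (G^`(1))%G.
Proof.
move=> solG maxM not_nMG; have prM := maxgroupp maxM.
have sMG := proper_sub prM; have ntG : G :!=: 1.
  by apply: contraTneq prM => ->; rewrite properE sub1G andbF.
apply/comax_adjP; split=> //; first exact: sol_der1_proper solG (subxx G) ntG.
apply: normal_maximal_mulg maxM (der_normal 1 G) _.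
by apply: contra not_nMG => sM; apply: sub_der1_normal.
Qed.

(** Proper subgroups of a nilpotent group are strictly contained in their
    normaliser, which for a maximal subgroup leaves only G. *)
Lemma nilpotent_maximal_normal M : nilpotent G -> maximal M G -> M <| G.
Proof.
move=> nilG maxM; have prM := maxgroupp maxM.
have prN := nilpotent_proper_norm nilG prM.
have [eqN | eqN] := maximal_overgroup maxM (proper_sub prN) (subsetIl _ _).
  by rewrite eqN properxx in prN.
by rewrite /normal (proper_sub prM) -{1}eqN subsetIr.
Qed.

(** Every vertex has a maximal neighbour, so a walk between maximal subgroups
    extends by one step at each end; vertices may repeat in a walk, so
    coincidences between the ends and the maximal subgroups do no harm. *)
Lemma comax_walks_from_maximal d :
  (forall M N, maximal M G -> maximal N G ->
     exists2 n, n <= d & has_walk (deleted_comax_graph G) M N n) ->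
  short_walks (deleted_comax_graph G) d.+2.
Proof.
move=> walk_max H K /deleted_comax_maximal_neighbour[M maxM HM].
case/deleted_comax_maximal_neighbour=> N maxN /comax_adj_sym NK.
have [n le_nd /has_walkP[p [pn Xp pN]]] := walk_max M N maxM maxN.
exists n.+2 => //; apply/has_walkP; exists (M :: rcons p K).
by rewrite /= size_rcons pn HM rcons_path Xp pN NK last_rcons.
Qed.

Lemma solvable_short_walks :
  solvable G -> short_walks (deleted_comax_graph G) 4.
Proof.
move=> solG; apply: comax_walks_from_maximal => M N maxM maxN.
have [<- | neqMN] := eqVneq M N.
  by exists 0 => //; apply/has_walkP; exists [::].
have [nNG | not_nNG] := boolP (N <| G).
  exists 1%N => //; apply/has_walkP; exists [:: N].
  by rewrite /= normal_maximal_adj.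
have [nMG | not_nMG] := boolP (M <| G).
  exists 1%N => //; apply/has_walkP; exists [:: N].
  by rewrite /= comax_adj_sym // normal_maximal_adj // eq_sym.
exists 2 => //; apply/has_walkP; exists [:: G^`(1)%G; N].
rewrite /= der1_nonnormal_maximal_adj // comax_adj_sym //.
exact: der1_nonnormal_maximal_adj.
Qed.

Lemma nilpotent_short_walks :
  nilpotent G -> short_walks (deleted_comax_graph G) 3.
Proof.
move=> nilG; apply: comax_walks_from_maximal => M N maxM maxN.
have [<- | neqMN] := eqVneq M N.
  by exists 0 => //; apply/has_walkP; exists [::].
exists 1%N => //; apply/has_walkP; exists [:: N].
by rewrite /= normal_maximal_adj // nilpotent_maximal_normal.
Qed.

(** A neighbour of the Frattini subgroup would generate G together with
    nongenerators only, hence would be G itself. *)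
Lemma Phi_isolated : isolated (comax_graph G) 'Phi(G)%G.
Proof.
apply/existsP=> -[K]; rewrite comax_adjE => /and3P[_ prK /eqP PhiK].
have genK : <<K>> = G.
  apply: Phi_nongen; rewrite norm_joinEr //.
  exact: subset_trans (proper_sub prK) (gFnorm _ _).
by rewrite genGid in genK; rewrite genK properxx in prK.
Qed.

Lemma nilpotent_not_isolated H :
  nilpotent G -> H \proper G -> ~~ (H \subset 'Phi(G)) ->
  ~~ isolated (comax_graph G) H.
Proof.
move=> nilG prH; have sHG := proper_sub prH; rewrite negbK => not_sHPhi.
have /exists_inP[M maxM not_sHM] :
    [exists (M : {group gT} | maximal M G), ~~ (H \subset M)].
  apply: contraR not_sHPhi; rewrite negb_exists_in => /forall_inP sHmax.
  apply/bigcapsP=> M /predU1P[-> // | maxM].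
  by have := sHmax M maxM; rewrite negbK.
apply/existsP; exists M.
rewrite comax_adjE prH (maxgroupp maxM) /=; apply/eqP/mulG_eq_groupC.
by rewrite (mulg_normal_maximal _ maxM) ?nilpotent_maximal_normal.
Qed.

Lemma nilpotent_deleted_comax_eq :
  nilpotent G -> deleted_comax_graph G = comax_graph G <-> 'Phi(G) = 1.
Proof.
move=> nilG; split=> [eqX | Phi1].
  apply/eqP; apply/negPn/negP => ntPhi.
  have VPhi : 'Phi(G)%G \in vertices (comax_graph G).
    rewrite inE ntPhi Phi_proper //; apply: contraNneq ntPhi => G1.
    by rewrite -subG1 -G1 Phi_sub.
  by move: VPhi; rewrite -eqX inE Phi_isolated andbF.
apply: sgraph_inj => //; apply/setP=> H; rewrite [LHS]inE.
apply: andb_idr; rewrite inE => /andP[ntH prH].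
by apply: nilpotent_not_isolated; rewrite // Phi1 subG1.
Qed.

End Comaximal.

Theorem corollary2p3 (gT : finGroupType) (G : {group gT}) :
  solvable G ->
  [/\ connected (deleted_comax_graph G),
      diam (deleted_comax_graph G) <= 4
    & nilpotent G ->
        diam (deleted_comax_graph G) <= 3 /\
        (deleted_comax_graph G = comax_graph G <-> 'Phi(G) = 1)].
Proof.
move=> solG; have walks4 := solvable_short_walks solG.
split; [exact: short_walks_connected walks4 | exact: short_walks_diam |].
move=> nilG; split; last exact: nilpotent_deleted_comax_eq.
exact/short_walks_diam/nilpotent_short_walks.
Qed.
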